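(* For every $\gamma\in(0,1]$, the ReportNoisyMax mechanism with Laplace scale $b=4/\gamma$ is $\gamma$-approximately truthful.
   Context: Setting: $n$ forecasters, $m$ binary events with outcomes $\vec y\in\{0,1\}^m$; forecaster $i$ has beliefs $p_i\in[0,1]^m$ (believing events independent) and reports $r_i\in[0,1]^m$. Quadratic score $S(q,y)=1-(y-q)^2$. ReportNoisyMax with scale $b>0$: compute $q_j=\sum_tS(r_{jt},y_t)$, draw independent $W_1,\dots,W_n$ with Laplace density $\frac1{2b}e^{-|w|/b}$, and select $\arg\max_j(q_j+W_j)$; $M(R,\vec y)$ is the resulting distribution over winners. $M(R;p_i)=\mathbb{E}_{\vec y\sim p_i}M(R,\vec y)$ with $y_t\sim\mathrm{Bernoulli}(p_{it})$ independently. For fixed $p_i$, $\hat r_i$ strictly dominates $r_i$ if $M(\hat r_i,R_{-i};p_i)_i>M(r_i,R_{-i};p_i)_i$ for all $R_{-i}$; $r_i$ is undominated otherwise. $\gamma$-approximately truthful: for all $p_i$ an undominated report exists and every undominated $r_i$ satisfies $\|r_i-p_i\|_\infty\le\gamma$.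
   Formalization: The formal statement assumes at least two forecasters (n ≥ 2); with a single forecaster, who wins with probability 1 whatever is reported, every report is undominated and the claim fails for γ < 1. *)

(* Defs.v *)
From HB Require Import structures.
From mathcomp Require Import all_boot all_order all_algebra.
From mathcomp Require Import all_classical all_reals all_analysis.

Set Implicit Arguments.
Unset Strict Implicit.
Unset Printing Implicit Defensive.

Import Order.TTheory GRing.Theory Num.Theory.
Import numFieldNormedType.Exports.

Local Open Scope ring_scope.

Section RNM.
Variable R : realType.

Definition qscore (q : R) (y : bool) : R := 1 - ((y%:R : R) - q) ^+ 2.

Definition total_score (m : nat) (r : 'I_m -> R) (y : {ffun 'I_m -> bool}) : R :=
  \sum_(t < m) qscore (r t) (y t).

Definition laplace_pdf (b w : R) : R := (2 * b)^-1 * expR (- (`|w| / b)).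

(* Winner of argmax_j (s j) with ties broken towards the smallest index:
   i wins iff s k < s i for k < i and s k <= s i for k > i. *)
Definition is_argmax (n : nat) (s : 'I_n -> R) (i : 'I_n) : bool :=
  [forall k : 'I_n, if (k < i)%N then s k < s i else s k <= s i].

(* Iterated Lebesgue integral over the first k coordinates of a noise vector
   w : nat -> R (coordinates are integrated in the order k-1, ..., 0). *)
Fixpoint iter_int (k : nat) (f : (nat -> R) -> \bar R) : \bar R :=
  match k with
  | 0 => f (fun _ => 0)
  | k'.+1 => (\int[lebesgue_measure]_(x in [set: R])
                iter_int k' (fun w => f (fun j => if j == k' then x else w j)))%E
  end.

(* M(R, y)_i : probability that ReportNoisyMax with scale b selects forecaster i,
   where W_1..W_n are i.i.d. Laplace(b). *)
Definition RNM_win (n m : nat) (b : R) (Rep : 'I_n -> 'I_m -> R)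
    (y : {ffun 'I_m -> bool}) (i : 'I_n) : \bar R :=
  iter_int n (fun w =>
    ((\prod_(j < n) laplace_pdf b (w j)) *
     (is_argmax (fun j : 'I_n => total_score (Rep j) y + w j) i)%:R)%:E).

Definition outcome_prob (m : nat) (p : 'I_m -> R) (y : {ffun 'I_m -> bool}) : R :=
  \prod_(t < m) (if y t then p t else 1 - p t).

Definition RNM_exp_win (n m : nat) (b : R) (Rep : 'I_n -> 'I_m -> R)
    (p : 'I_m -> R) (i : 'I_n) : \bar R :=
  (\sum_(y : {ffun 'I_m -> bool}) (outcome_prob p y)%:E * RNM_win b Rep y i)%E.

Definition in01 (m : nat) (v : 'I_m -> R) : Prop := forall t, 0 <= v t <= 1.

Definition upd_report (n m : nat) (Rep : 'I_n -> 'I_m -> R) (i : 'I_n)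
    (r : 'I_m -> R) : 'I_n -> 'I_m -> R :=
  fun j => if j == i then r else Rep j.

Definition strictly_dominates (n m : nat) (b : R) (p : 'I_m -> R) (i : 'I_n)
    (rhat r : 'I_m -> R) : Prop :=
  forall Rep : 'I_n -> 'I_m -> R, (forall j, j != i -> in01 (Rep j)) ->
    (RNM_exp_win b (upd_report Rep i r) p i < RNM_exp_win b (upd_report Rep i rhat) p i)%E.

Definition undominated (n m : nat) (b : R) (p : 'I_m -> R) (i : 'I_n)
    (r : 'I_m -> R) : Prop :=
  in01 r /\ ~ (exists rhat, in01 rhat /\ strictly_dominates b p i rhat r).

Definition approx_truthful (n m : nat) (b gamma : R) : Prop :=
  forall (i : 'I_n) (p : 'I_m -> R), in01 p ->
    (exists r, undominated b p i r) /\
    (forall r, undominated b p i r -> forall t, `|r t - p t| <= gamma).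

End RNM.

(* Main.v *)
Require Import Defs.
From HB Require Import structures.
From mathcomp Require Import all_boot all_order all_algebra.
From mathcomp Require Import all_classical all_reals all_analysis.
From mathcomp Require Import measurable_realfun lebesgue_integral_fubini.
From mathcomp Require Import ring lra.
Import Order.TTheory GRing.Theory Num.Theory.
Import numFieldNormedType.Exports.
Local Open Scope ring_scope.
Set Implicit Arguments.
Unset Strict Implicit.
Unset Printing Implicit Defensive.

(* Fix the noise of the rivals of forecaster i. Then i wins exactly when its own
   noise exceeds z - q, where z is the best noisy score of a rival and q the score
   of i, so it wins with probability tail (z - q) for the Laplace tail. Suppose
   |r_t - p_t| > gamma and replace r_t by p_t. Pair each outcome y with the one
   that differs from it at event t: the score of i changes in expectation by
   + (p_t - r_t)^2, and the two values of z differ by at most 1, so that all the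
   points at which the tail is evaluated lie in an interval of length 2. There the
   Laplace density varies by a factor of at most exp (2 / b) = exp (gamma / 2)
   <= 1 + gamma, which is too little to outweigh the expected gain. Hence the
   winning probability increases for every noise of the rivals, and r is
   dominated. A maximiser of the continuous winning probability against the
   rivals that always report 0 is undominated. *)

(** * Iterated Lebesgue integrals as integrals over a product space *)

Section SigmaFiniteProduct.
Context d1 d2 (T1 : measurableType d1) (T2 : measurableType d2) (R : realType).
Variables (m1 : {sigma_finite_measure set T1 -> \bar R})
  (m2 : {sigma_finite_measure set T2 -> \bar R}).

(* The canonical sigma-finite structure on [m1 \x m2] is only inferred for
   subprobabilities, hence this alias. *)
Definition sigma_finite_product : set (T1 * T2) -> \bar R := (m1 \x m2)%E.

HB.instance Definition _ := Measure.on sigma_finite_product.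
HB.instance Definition _ := Measure_isSigmaFinite.Build _ _ _
  sigma_finite_product
  (lebesgue_integral_fubini.product_measure_sigma_finite_subproof m1 m2).

Local Open Scope classical_set_scope.
Local Open Scope ereal_scope.

Lemma sigma_finite_product_gt0 :
  0 < m1 setT -> 0 < m2 setT -> 0 < sigma_finite_product setT.
Proof.
move=> m10 m20.
by rewrite /sigma_finite_product -setXTT [ltRHS]product_measure1E// mule_gt0.
Qed.

Lemma integral_sigma_finite_product f :
  measurable_fun [set: T1 * T2] f -> (forall z, 0 <= f z) ->
  \int[sigma_finite_product]_z f z = \int[m2]_y \int[m1]_x f (x, y).
Proof. exact: fubini_tonelli2. Qed.

End SigmaFiniteProduct.

Section IterInt.
Variable R : realType.
Local Open Scope classical_set_scope.
Local Open Scope ereal_scope.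

Let lebesgue_measure_setT_gt0 : 0 < @lebesgue_measure R setT.
Proof.
by rewrite -set_itvNyy lebesgue_measure_itv; exact: ltry.
Qed.

Definition set_coord (w : nat -> R) (i : nat) (x : R) : nat -> R :=
  fun j => if j == i then x else w j.

(* Joint measurability without a sigma-algebra on [nat -> R]. *)
Definition coord_measurable (f : (nat -> R) -> \bar R) : Prop :=
  forall d (S : measurableType d) (Y : S -> nat -> R),
    (forall j, measurable_fun [set: S] (fun s => Y s j)) ->
    measurable_fun [set: S] (fun s => f (Y s)).

Lemma measurable_set_coord d1 d2 (S1 : measurableType d1)
    (S2 : measurableType d2) (Y : S1 -> nat -> R) (g : S2 -> R) i j :
  (forall j, measurable_fun [set: S1] (fun s => Y s j)) ->
  measurable_fun [set: S2] g ->
  measurable_fun [set: S1 * S2] (fun s => set_coord (Y s.1) i (g s.2) j).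
Proof.
move=> mY mg; rewrite /set_coord; case: (j == i).
  exact: (measurableT_comp mg measurable_snd).
exact: (measurableT_comp (mY j) measurable_fst).
Qed.

Lemma coord_measurable_set_coord f i x :
  coord_measurable f -> coord_measurable (fun w => f (set_coord w i x)).
Proof.
move=> mf d S Y mY; apply: mf => j; rewrite /set_coord; case: (j == i) => //.
Qed.

(** The space is a one-point space times [k] copies of the line, and [X] reads off the coordinates.
    Positivity of the total mass is recorded because strict inequalities between integrals depend on
    it later. *)
Lemma iter_int_product (k : nat) :
  exists (d : measure_display) (T : measurableType d)
    (P : {sigma_finite_measure set T -> \bar R}) (X : T -> nat -> R),
  [/\ 0 < P [set: T], forall j, measurable_fun [set: T] (fun t => X t j) &
    forall f, coord_measurable f -> (forall w, 0 <= f w) ->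
      iter_int k f = \int[P]_(t in [set: T]) f (X t)].
Proof.
elim: k => [|k [d [T [P [X [P0 mX PX]]]]]].
  exists _, unit, (@dirac _ unit tt R), (fun _ _ => 0%R); split.
  - by rewrite /= diracE in_setT.
  - by move=> j; exact: measurable_cst.
  - move=> f mf f0 /=. rewrite integral_dirac//= ?diracT ?mul1e//.

pose L : {sigma_finite_measure set (measurableTypeR R) -> \bar R} :=
  [the {sigma_finite_measure set _ -> \bar R} of @lebesgue_measure R].
exists (measure_prod_display (d, _)), (T * measurableTypeR R)%type.
exists (sigma_finite_product P L).
exists (fun z => set_coord (X z.1) k z.2); split.
- exact: sigma_finite_product_gt0.
- by move=> j; exact: (measurable_set_coord (g := id)).
- move=> f mf f0 /=.
  rewrite (integral_sigma_finite_product P L (f := fun z => f (set_coord (X z.1) k z.2))).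
  + by apply: eq_integral => x _; rewrite PX//; exact: coord_measurable_set_coord.
  + by apply: mf => j; exact: (measurable_set_coord (g := id)).
  + by move=> z; exact: f0.
Qed.

(** Tonelli brings the integral over the noise of forecaster [i] innermost, so that the noise of the
    rivals can be held fixed. Induction on [k]: if [i] is the outermost coordinate one exchange
    suffices, otherwise the outermost coordinate joins the product space. *)
Lemma iter_int_isolate (k i : nat) : (i < k)%N ->
  exists (d : measure_display) (T : measurableType d)
    (P : {sigma_finite_measure set T -> \bar R}) (X : T -> nat -> R),
  [/\ 0 < P [set: T], forall j, measurable_fun [set: T] (fun t => X t j) &
    forall f, coord_measurable f -> (forall w, 0 <= f w) ->
      iter_int k f = \int[P]_(t in [set: T])
        \int[lebesgue_measure]_(x in [set: R]) f (set_coord (X t) i x)].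
Proof.
pose L : {sigma_finite_measure set (measurableTypeR R) -> \bar R} :=
  [the {sigma_finite_measure set _ -> \bar R} of @lebesgue_measure R].
elim: k => [//|k IH]; rewrite ltnS leq_eqVlt => /predU1P[->|ik].
  have [d [T [P [X [P0 mX PX]]]]] := iter_int_product k.
  exists d, T, P, X; split => // f mf f0 /=.
  rewrite (fubini_tonelli (m1 := P) (m2 := L)
    (fun z => f (set_coord (X z.1) k z.2))).
  + by apply: eq_integral => x _; rewrite PX//; exact: coord_measurable_set_coord.
  + by apply: mf => j; exact: (measurable_set_coord (g := id)).
  + by move=> z; exact: f0.
have [d [T [P [X [P0 mX PX]]]]] := IH ik.
exists (measure_prod_display (d, _)), (T * measurableTypeR R)%type.
exists (sigma_finite_product P L).
exists (fun z => set_coord (X z.1) k z.2); split.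
- exact: sigma_finite_product_gt0.
- by move=> j; exact: (measurable_set_coord (g := id)).
- move=> f mf f0 /=.
  pose F (z : T * measurableTypeR R) : \bar R :=
    \int[L]_(x in [set: R]) f (set_coord (set_coord (X z.1) k z.2) i x).
  (* Updates at the distinct indices [i < k] commute. *)
  have swap w x y :
      set_coord (set_coord w i x) k y = set_coord (set_coord w k y) i x.
    apply/funext => j; rewrite /set_coord.
    by case: eqP => // ->; rewrite gtn_eqF.
  rewrite (integral_sigma_finite_product P L (f := F)).
  + apply: eq_integral => y _; rewrite PX//; last exact: coord_measurable_set_coord.
    apply: eq_integral => t _; apply: eq_integral => x _.
    by rewrite -/(set_coord (set_coord (X t) i x) k y) swap.
  + apply: (measurable_fun_fubini_tonelli_F
      (fun u : (T * measurableTypeR R) * measurableTypeR R =>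
         f (set_coord (set_coord (X u.1.1) k u.1.2) i u.2))) => //.
    apply: mf => j; apply: (measurable_set_coord
      (S1 := (T * measurableTypeR R)%type) (Y := fun z => set_coord (X z.1) k z.2) (g := id)) => //.
    by move=> l; exact: (measurable_set_coord (g := id)).
  + by move=> z; exact: integral_ge0.
Qed.
End IterInt.

(** * The Laplace tail *)

Section Laplace.
Variables (R : realType) (b : R).
Hypothesis b0 : 0 < b.
Local Open Scope classical_set_scope.
Notation mu := (@lebesgue_measure R).

Lemma laplace_pdf_gt0 x : 0 < laplace_pdf b x.
Proof. by rewrite mulr_gt0 ?expR_gt0// invr_gt0 mulr_gt0. Qed.

Lemma laplace_pdf_le x : laplace_pdf b x <= (2 * b)^-1.
Proof.
rewrite ler_piMr ?invr_ge0 ?mulr_ge0 ?(ltW b0)//.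
by rewrite -expR0 ler_expR oppr_le0 divr_ge0// ltW.
Qed.

Lemma continuous_laplace_pdf : continuous (laplace_pdf b).
Proof.
move=> x; rewrite /continuous_at /laplace_pdf.
apply: cvgM; first exact: cvg_cst.
apply: continuous_cvg; first exact: continuous_expR.
by apply: cvgN; apply: cvgM; [exact: cvg_norm | exact: cvg_cst].
Qed.

Lemma measurable_laplace_pdf : measurable_fun [set: R] (laplace_pdf b).
Proof. exact: continuous_measurable_fun continuous_laplace_pdf. Qed.

(** Triangle inequality in the exponent. This multiplicative stability of the density under shifts
    is the privacy property of Laplace noise. *)
Lemma laplace_pdf_ratio x y :
  laplace_pdf b x <= expR (`|x - y| / b) * laplace_pdf b y.
Proof.
rewrite mulrCA ler_wpM2l ?invr_ge0 ?mulr_ge0 ?(ltW b0)//.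
rewrite -expRD ler_expR -mulrBl -mulNr ler_pM2r ?invr_gt0//.
have := ler_normD (y - x) x; rewrite subrK distrC => H.
lra.
Qed.

(** By symmetry it is enough to integrate over the half-line, where the function is half the
    exponential density of rate [b^-1]. *)
Lemma integrable_laplace_pdf : mu.-integrable setT (EFin \o laplace_pdf b).
Proof.
have mE : measurable_fun [set: R] (EFin \o laplace_pdf b).
  by apply/measurable_EFinP; exact: measurable_laplace_pdf.
apply/integrableP; split => //.
under eq_integral do rewrite /= ger0_norm ?(ltW (laplace_pdf_gt0 _))//.
rewrite ge0_symfun_integralT//; last 3 first.
- by move=> x; exact/ltW/laplace_pdf_gt0.
- exact: continuous_laplace_pdf.
- by move=> x; rewrite /laplace_pdf /= normrN.
rewrite lte_mul_pinfty//.
have i0 : 0 < b^-1 by rewrite invr_gt0.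
have /integrableP[_] := integrable_exponential_pdf i0.
under eq_integral do rewrite /= ger0_norm ?exponential_pdf_ge0 ?(ltW i0)//.
apply: le_lt_trans.
have mS : measurable [set x : R | 0 <= x].
  by rewrite -[X in measurable X]/[set x | [pred z | 0 <= z] x] -set_itvcy.
have mX : measurable_fun [set: R] (EFin \o exponential_pdf b^-1).
  apply/measurable_EFinP; exact: measurable_exponential_pdf.
apply: (@le_trans _ _ (\int[mu]_(x in [set x : R | (0 <= x)%R]) (exponential_pdf b^-1 x)%:E)%E).
  apply: ge0_le_integral => //.
  - by move=> x _; rewrite lee_fin; exact/ltW/laplace_pdf_gt0.
  - exact: measurable_funTS.
  - exact: measurable_funTS.
  - move=> x x0; rewrite lee_fin exponential_pdfE// /laplace_pdf ger0_norm//.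
    rewrite mulNr [x / b]mulrC ler_wpM2r ?expR_ge0// invfM.
    by rewrite ler_piMl ?(ltW i0)//; lra.
apply: ge0_subset_integral => //.
by move=> x _; rewrite lee_fin exponential_pdf_ge0// ltW.
Qed.

Definition laplace_tail (z : R) : R := \int[mu]_(x in `]z, +oo[) laplace_pdf b x.

Lemma laplace_tailB x y : x <= y ->
  laplace_tail x - laplace_tail y = \int[mu]_(z in `]x, y]) laplace_pdf b z.
Proof.
move=> xy; apply/eqP; rewrite subr_eq; apply/eqP; rewrite /laplace_tail.
have -> : `]x, +oo[ = `]x, y] `|` `]y, +oo[.
  by rewrite (@itv_bndbnd_setU _ _ (BRight x) (BRight y) +oo%O)// bnd_simp.
rewrite Rintegral_setU//.
  by apply: integrableS integrable_laplace_pdf => //; exact: measurableU.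
apply/disj_setPS => z /= [].
by rewrite !in_itv/= andbT => /andP[_ zy] /lt_geF; rewrite zy.
Qed.

(** Mean value estimate: it turns density bounds on a window into bounds on the change of winning
    probability. *)
Lemma laplace_tailB_bounds x y l u : x <= y ->
  (forall z, x < z <= y -> l <= laplace_pdf b z <= u) ->
  (y - x) * l <= laplace_tail x - laplace_tail y <= (y - x) * u.
Proof.
move=> xy H; rewrite laplace_tailB//.
have mI : fine (mu `]x, y]) = y - x.
  rewrite lebesgue_measure_itv/= lte_fin; case: ltgtP xy => //.
  by move=> -> _; rewrite subrr.
have ic r : mu.-integrable `]x, y] (EFin \o cst r).
  apply: measurable_bounded_integrable => //=.
    by rewrite lebesgue_measure_itv/= lte_fin; case: ifP => // _; rewrite -EFinB ltry.
  exists `|r|; split; first exact: normr_real.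
  by move=> M rM z _ /=; exact: ltW.
have il : mu.-integrable `]x, y] (EFin \o laplace_pdf b).
  by apply: integrableS integrable_laplace_pdf.
have cstE r : (y - x) * r = \int[mu]_(z in `]x, y]) r.
  by rewrite Rintegral_cst// mI mulrC.
rewrite !cstE; apply/andP; split.
- by apply: le_Rintegral; [|exact: (ic l)|exact: il|];
    rewrite // => z /=; rewrite in_itv/= => /H/andP[].
- by apply: le_Rintegral; [|exact: il|exact: (ic u)|];
    rewrite // => z /=; rewrite in_itv/= => /H/andP[].
Qed.

(** Kept as a symbol: it enters through its positivity, its finiteness and as an upper bound for the
    tail. *)
Definition laplace_mass : R := \int[mu]_(x in [set: R]) laplace_pdf b x.

Lemma laplace_tail_ge0 x : 0 <= laplace_tail x.
Proof. by apply: Rintegral_ge0 => z _; exact/ltW/laplace_pdf_gt0. Qed.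

Lemma laplace_tail_le_mass z : laplace_tail z <= laplace_mass.
Proof.
rewrite fine_le//.
- apply: integrable_fin_num => //.
  by apply: integrableS (integrable_laplace_pdf).
- by apply: integrable_fin_num => //; exact: integrable_laplace_pdf.
apply: ge0_subset_integral => //.
  by apply/measurable_EFinP; exact: measurable_laplace_pdf.
by move=> x _; rewrite lee_fin; exact/ltW/laplace_pdf_gt0.
Qed.

Lemma laplace_mass_gt0 : 0 < laplace_mass.
Proof.
have e0 : 0 < expR (1 / b) by exact: expR_gt0.
apply: (@lt_le_trans _ _ (laplace_tail 0 - laplace_tail 1)); last first.
  by rewrite lerBlDr (le_trans (laplace_tail_le_mass 0))// lerDl laplace_tail_ge0.
have bnd z : 0 < z <= 1 ->
    laplace_pdf b 0 / expR (1 / b) <= laplace_pdf b z <= (2 * b)^-1.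
  move=> /andP[z0 z1]; rewrite laplace_pdf_le// andbT ler_pdivrMr// mulrC.
  apply: (le_trans (laplace_pdf_ratio 0 z)).
  rewrite ler_wpM2r ?(ltW (laplace_pdf_gt0 _))// ler_expR ler_pM2r ?invr_gt0//.
  by rewrite sub0r normrN ger0_norm// ltW.
have /andP[+ _] := laplace_tailB_bounds ler01 bnd.
by apply: lt_le_trans; rewrite subr0 !mul1r mulr_gt0 ?invr_gt0 ?expR_gt0// laplace_pdf_gt0.
Qed.

Lemma laplace_tail_lipschitz x y :
  `|laplace_tail x - laplace_tail y| <= (2 * b)^-1 * `|x - y|.
Proof.
wlog xy : x y / x <= y.
  move=> H; have [/H//|/ltW/H] := leP x y.
  by rewrite distrC [`|y - x|]distrC.
have /andP[l u] := @laplace_tailB_bounds x y 0 (2 * b)^-1 xy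
  (fun z _ => introT andP (conj (ltW (laplace_pdf_gt0 z)) (laplace_pdf_le z))).
rewrite mulr0 in l; rewrite ger0_norm// (le_trans u)//.
by rewrite distrC ger0_norm ?subr_ge0// mulrC.
Qed.

End Laplace.

(** * Expected gain at one event *)

Section Gain.
Variables (R : realType) (gamma b : R).
Hypotheses (gamma0 : 0 < gamma) (gamma1 : gamma <= 1) (bE : b = 4 / gamma).
Local Notation tail := (laplace_tail b).

(** The left side is [expR (gamma / 2)]. Its inverse is at least [1 - gamma / 2], and
    [(1 + gamma) * (1 - gamma / 2) >= 1] because [gamma ^+ 2 <= gamma]. *)
Lemma expR_two_div_scale : expR (1 / b) ^+ 2 <= 1 + gamma.
Proof.
have -> : expR (1 / b) ^+ 2 = (expR (- (gamma / 2)))^-1.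
  rewrite -expRN opprK -expRM_natl; congr expR.
  by rewrite bE; field; rewrite gt_eqF.
have h := expR_ge1Dx (- (gamma / 2)).
have h0 : 0 < 1 - gamma / 2.
  by have g1 := gamma1; lra.
apply: (@le_trans _ _ (1 - gamma / 2)^-1).
  by rewrite lef_pV2 ?posrE ?expR_gt0.
have gg : gamma * gamma <= gamma by rewrite ler_piMl// ltW.
rewrite -[leLHS]mul1r ler_pdivrMr//.
by have -> : (1 + gamma) * (1 - gamma / 2) = 1 + (gamma - gamma * gamma) / 2 by [field]; lra.
Qed.

Lemma qscore_in01 (q : R) y : 0 <= q <= 1 -> 0 <= qscore q y <= 1.
Proof.
by move=> /andP[q0 q1]; rewrite /qscore; case: y => /=; apply/andP; split; nra.
Qed.

(** Here [z1] and [z0] are the best rival scores under the two outcomes of the event, and [s] is the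
    score from the other events. Raising the report from [r] to [p] adds [(p - r) * (2 - p - r)] to
    the score if the event occurs and costs [(p - r) * (p + r)] if not; the density is bounded below
    in the gain and above in the loss. *)
Lemma expected_gain_lt (p r s z1 z0 : R) :
  0 <= p <= 1 -> 0 <= r <= 1 -> gamma < p - r -> `|z1 - z0| <= 1 ->
  0 < p * (tail (z1 - s - qscore p true) - tail (z1 - s - qscore r true))
    + (1 - p) * (tail (z0 - s - qscore p false) - tail (z0 - s - qscore r false)).
Proof.
have b0 : 0 < b by rewrite bE divr_gt0.
have g0 := gamma0; have g1 := gamma1.
move=> hp hr hD /ler_normlP[hz1 hz2].
have /andP[Sp1 Sp1'] := qscore_in01 true hp.
have /andP[Sp0 Sp0'] := qscore_in01 false hp.
have /andP[Sr1 Sr1'] := qscore_in01 true hr.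
have /andP[Sr0 Sr0'] := qscore_in01 false hr.
have E1 : qscore p true - qscore r true = (p - r) * (2 - p - r).
  by rewrite /qscore /=; ring.
have E0 : qscore r false - qscore p false = (p - r) * (p + r).
  by rewrite /qscore /=; ring.
move/andP: hp => [p0 p1]; move/andP: hr => [r0 r1].
(* Each [z] is within 1/2 of the midpoint and each score lies in [[0, 1]], so all four thresholds
   are within 1 of [xi]. *)
set xi := (z1 + z0) / 2 - s - 1 / 2.
set c := laplace_pdf b xi; set kappa := expR (1 / b).
have c0 : 0 < c by exact: laplace_pdf_gt0.
have k0 : 0 < kappa by exact: expR_gt0.
have kN0 : kappa != 0 by rewrite gt_eqF.
have bnd z : `|z - xi| <= 1 -> c / kappa <= laplace_pdf b z <= kappa * c.
  move=> zxi; have kz : expR (`|z - xi| / b) <= kappa.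
    by rewrite ler_expR ler_pM2r ?invr_gt0.
  apply/andP; split.
    rewrite ler_pdivrMr// mulrC (le_trans (laplace_pdf_ratio b0 xi z))// distrC.
    by rewrite ler_wpM2r// ltW// laplace_pdf_gt0.
  by rewrite (le_trans (laplace_pdf_ratio b0 z xi))// ler_wpM2r// ltW.
have d1 : 0 <= (p - r) * (2 - p - r) by rewrite mulr_ge0; lra.
have d0 : 0 <= (p - r) * (p + r) by rewrite mulr_ge0; lra.
have /andP[G1 _] : (p - r) * (2 - p - r) * (c / kappa) <=
    tail (z1 - s - qscore p true) - tail (z1 - s - qscore r true) <=
    (p - r) * (2 - p - r) * (kappa * c).
  rewrite -E1 (_ : qscore p true - qscore r true =
    z1 - s - qscore r true - (z1 - s - qscore p true)); last by ring.
  apply: laplace_tailB_bounds => //; first by lra.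
  by move=> z /andP[za zb]; apply: bnd; rewrite ler_norml /xi; apply/andP; split; lra.
have /andP[_ G0] : (p - r) * (p + r) * (c / kappa) <=
    tail (z0 - s - qscore r false) - tail (z0 - s - qscore p false) <=
    (p - r) * (p + r) * (kappa * c).
  rewrite -E0 (_ : qscore r false - qscore p false =
    z0 - s - qscore p false - (z0 - s - qscore r false)); last by ring.
  apply: laplace_tailB_bounds => //; first by lra.
  by move=> z /andP[za zb]; apply: bnd; rewrite ler_norml /xi; apply/andP; split; lra.
(* After division by [p - r], this rests on [p * (2 - p - r) - (1 - p) * (p + r) = p - r > gamma],
   whereas the factor [kappa ^+ 2 <= 1 + gamma] enlarges a term that is at most 1. *)
have key : (1 - p) * ((p - r) * (p + r)) * kappa ^+ 2 < p * ((p - r) * (2 - p - r)).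
  have k2 := expR_two_div_scale.
  rewrite (_ : (1 - p) * ((p - r) * (p + r)) * kappa ^+ 2 =
    (p - r) * ((1 - p) * (p + r) * kappa ^+ 2)); last by ring.
  rewrite (_ : p * ((p - r) * (2 - p - r)) = (p - r) * (p * (2 - p - r))); last by ring.
  rewrite ltr_pM2l; last by lra.
  have u0 : 0 <= (1 - p) * (p + r) by rewrite mulr_ge0; lra.
  have u1 : (1 - p) * (p + r) <= 1 by nra.
  apply: (@le_lt_trans _ _ ((1 - p) * (p + r) * (1 + gamma))).
    by rewrite ler_wpM2l.
  have : (1 - p) * (p + r) * gamma <= gamma by rewrite ler_piMl// ltW.
  lra.
have key' : (1 - p) * ((p - r) * (p + r) * (kappa * c)) <
    p * ((p - r) * (2 - p - r) * (c / kappa)).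
  rewrite (_ : (1 - p) * ((p - r) * (p + r) * (kappa * c)) =
    (1 - p) * ((p - r) * (p + r)) * kappa ^+ 2 * (c / kappa)); last by field.
  rewrite (_ : p * ((p - r) * (2 - p - r) * (c / kappa)) =
    p * ((p - r) * (2 - p - r)) * (c / kappa)); last by field.
  by rewrite ltr_pM2r// divr_gt0.
have := ler_wpM2l p0 G1.
have p1' : 0 <= 1 - p by lra.
have := ler_wpM2l p1' G0.
lra.
Qed.

Lemma expected_gain (p r s z1 z0 : R) :
  0 <= p <= 1 -> 0 <= r <= 1 -> gamma < `|r - p| -> `|z1 - z0| <= 1 ->
  0 < p * (tail (z1 - s - qscore p true) - tail (z1 - s - qscore r true))
    + (1 - p) * (tail (z0 - s - qscore p false) - tail (z0 - s - qscore r false)).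
Proof.
have g0 := gamma0; move=> hp hr; rewrite ltr_normr => /orP[h|h] hz; last first.
  by apply: expected_gain_lt => //; lra.
(* Overestimates reduce to underestimates by exchanging the names of the two outcomes. *)
have flip (q : R) y : qscore (1 - q) y = qscore q (~~ y).
  by rewrite /qscore; case: y => /=; ring.
have : 0 < (1 - p) * (tail (z0 - s - qscore (1 - p) true) -
      tail (z0 - s - qscore (1 - r) true))
    + (1 - (1 - p)) * (tail (z1 - s - qscore (1 - p) false) -
      tail (z1 - s - qscore (1 - r) false)).
  by apply: expected_gain_lt; [lra|lra|lra|rewrite distrC].
by rewrite !flip /= subKr addrC.
Qed.

End Gain.

(** * The winning probability given the noise of the rivals *)

Section BestRival.
Variables (R : realType) (n : nat) (i k0 : 'I_n).
Hypothesis k0i : k0 != i.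

(** The seed [a k0] replaces a least element; as [k0] is itself a rival, it does not alter the
    maximum. *)
Definition best_rival (a : 'I_n -> R) : R := \big[Num.max/a k0]_(k | k != i) a k.

Lemma best_rival_leP a c :
  reflect (forall k, k != i -> a k <= c) (best_rival a <= c).
Proof.
apply: (iffP (bigmax_leP _ _ _ _)) => [[] //|H]; split => //; exact: H.
Qed.

Lemma best_rival_dist a a' (e : R) :
  (forall k, k != i -> `|a k - a' k| <= e) -> `|best_rival a - best_rival a'| <= e.
Proof.
have H u v : (forall k, k != i -> `|u k - v k| <= e) ->
    best_rival u - best_rival v <= e.
  move=> uv; rewrite lerBlDr; apply/best_rival_leP => k ki.
  have := uv _ ki; have /best_rival_leP/(_ _ ki) := lexx (best_rival v).
  by move=> vk /ler_normlP[]; lra.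
move=> aa'; apply/ler_normlP; rewrite opprB; split; apply: H => // k ki.
by rewrite distrC aa'.
Qed.

(** With the next lemma, winning is squeezed between the strict and the weak inequality, so that
    tie-breaking matters only at equality. *)
Lemma is_argmax_gt a : best_rival a < a i -> is_argmax a i.
Proof.
move=> Ha; apply/forallP => k; have [->|ki] := eqVneq k i; first by rewrite ltnn.
have aki : a k < a i.
  by apply: le_lt_trans Ha; have /best_rival_leP/(_ _ ki) := lexx (best_rival a).
by case: ifP => // _; exact: ltW.
Qed.

Lemma is_argmax_best_rival a : is_argmax a i -> best_rival a <= a i.
Proof.
move=> /forallP Ha; apply/best_rival_leP => k ki.
by move: (Ha k); case: ifP => // _ /ltW.
Qed.

End BestRival.

Lemma measurable_fun_forall d (T : measurableType d) (I : finType)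
    (B : I -> T -> bool) :
  (forall k, measurable_fun [set: T]%classic (B k)) ->
  measurable_fun [set: T]%classic (fun t => [forall k, B k t]).
Proof.
move=> mB.
rewrite (_ : (fun t => _) = fun t => all (B ^~ t) (enum I)); last first.
  apply/funext => t; apply/forallP/allP => H k; first by move=> _; exact: H.
  by apply: H; rewrite mem_enum.
elim: (enum I) => [|k r IH] /=; first exact: measurable_cst.
exact: measurable_and.
Qed.

Section WinningProbability.
Variables (R : realType) (b : R).
Hypothesis b0 : 0 < b.
Local Open Scope classical_set_scope.
Notation mu := (@lebesgue_measure R).

(** The constant [c] is general so that the induction can absorb the density of the outermost
    coordinate into it. *)
Lemma iter_int_laplace_prod (c : R) (k : nat) : 0 <= c ->
  iter_int k (fun w => (c * \prod_(j < k) laplace_pdf b (w j))%:E) =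
  (c * laplace_mass b ^+ k)%:E.
Proof.
elim: k c => [|k IH] c c0; first by rewrite /= big_ord0.
transitivity (\int[mu]_x (laplace_pdf b x * (c * laplace_mass b ^+ k))%:E)%E.
  rewrite [LHS]/=; apply: eq_integral => x _.
  rewrite [laplace_pdf b x * _]mulrA -IH; last first.
    by rewrite mulr_ge0// ltW// laplace_pdf_gt0.
  congr iter_int; apply/funext => w; congr EFin.
  rewrite big_ord_recr /= eqxx.
  under eq_bigr => j _ do rewrite ltn_eqF//.
  by ring.
under eq_integral do rewrite EFinM.
rewrite ge0_integralZr//; last 3 first.
- by apply/measurable_EFinP; exact: measurable_laplace_pdf.
- by move=> x _; rewrite lee_fin; exact/ltW/laplace_pdf_gt0.
- by rewrite lee_fin mulr_ge0// exprn_ge0// ltW// laplace_mass_gt0.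
rewrite exprS mulrCA [in RHS]EFinM; congr (_ * _)%E; rewrite /laplace_mass /Rintegral fineK//.
by apply: integrable_fin_num => //; exact: integrable_laplace_pdf.
Qed.

Definition win_density n (i : 'I_n) (s : 'I_n -> R) (w : nat -> R) : \bar R :=
  ((\prod_(j < n) laplace_pdf b (w j)) *
     (is_argmax (fun j : 'I_n => s j + w j) i)%:R)%:E.

Lemma win_density_ge0 n (i : 'I_n) s w : (0 <= win_density i s w)%E.
Proof.
rewrite lee_fin mulr_ge0// prodr_ge0// => j _.
exact/ltW/laplace_pdf_gt0.
Qed.

Lemma coord_measurable_laplace_prod n :
  coord_measurable (fun w => (\prod_(j < n) laplace_pdf b (w j))%:E).
Proof.
move=> d S Y mY; apply/measurable_EFinP; apply: measurable_prod => j _.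
by apply: measurableT_comp (mY j); exact: measurable_laplace_pdf.
Qed.

Lemma coord_measurable_win_density n (i : 'I_n) s :
  coord_measurable (win_density i s).
Proof.
move=> d S Y mY; apply/measurable_EFinP; apply: measurable_funM.
  apply: measurable_prod => j _.
  by apply: measurableT_comp (mY j); exact: measurable_laplace_pdf.
have boolE (B : S -> bool) : measurable_fun setT B ->
    measurable_fun setT (fun t => (B t)%:R : R).
  move=> mB; rewrite (_ : (fun t => _) = (fun t => if B t then 1 else 0)).
    exact: measurable_fun_ifT.
  by apply/funext => t; case: (B t).
apply: boolE; apply: measurable_fun_forall => k.
case: (k < i)%N; [apply: measurable_fun_ltr|apply: measurable_fun_ler];
  by apply: measurable_funD; [exact: measurable_cst|exact: mY].
Qed.

(** As a function of its own noise, [i] wins on a half-line starting at the best rival score minus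
    [s i]; the endpoint is a null set. *)
Lemma win_density_set_coord n (i k0 : 'I_n) (s : 'I_n -> R) w : k0 != i ->
  (\int[mu]_x win_density i s (set_coord w i x) =
  ((\prod_(j < n | j != i) laplace_pdf b (w j)) *
     laplace_tail b (best_rival i k0 (fun k => s k + w k) - s i))%:E)%E.
Proof.
move=> k0i; set rho := \prod_(j < n | j != i) _; set th := best_rival _ _ _.
pose win x := is_argmax (fun j : 'I_n => s j + set_coord w i x j) i.
have rho0 : 0 <= rho by apply: prodr_ge0 => j _; exact/ltW/laplace_pdf_gt0.
have dE x : win_density i s (set_coord w i x) =
    (rho%:E * (laplace_pdf b x * (win x)%:R)%:E)%E.
  rewrite -EFinM mulrA; congr (_ * _)%:E.
  rewrite (bigD1 i)//= {1}/set_coord eqxx mulrC; congr (_ * _).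
  by apply: eq_bigr => j ji; rewrite /set_coord ifN.
have brE x : best_rival i k0 (fun j => s j + set_coord w i x j) = th.
  rewrite /th /best_rival {1}/set_coord ifN//.
  by apply: eq_bigr => j ji; rewrite /set_coord ifN.
have siE x : s i + set_coord w i x i = s i + x by rewrite /set_coord eqxx.
have win_gt x : th - s i < x -> win x.
  move=> tx; apply: (is_argmax_gt k0i).
  by rewrite brE siE -ltrBlDl.
have win_lt x : x < th - s i -> win x = false.
  move=> xt; apply/negP => /(is_argmax_best_rival k0i).
  by rewrite brE siE -lerBlDl leNgt xt.
(* The half-line is closed exactly when [i] wins the tie at its endpoint. *)
pose I := Interval (BSide (win (th - s i)) (th - s i)) +oo%O.
have winE x : win x = (x \in I).
  rewrite /I; case: (ltgtP x (th - s i)) => xt.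
  - by rewrite win_lt// in_itv/= andbT; case: (win _) => /=; rewrite ?leNgt ?xt//
      ltNge ltW.
  - by rewrite win_gt// in_itv/= andbT; case: (win _) => /=; rewrite ?xt// ltW.
  - by rewrite xt in_itv/= andbT; case: (win _) => /=; rewrite ?lexx ?ltxx.
have mpdf : measurable_fun [set: R] (EFin \o laplace_pdf b).
  by apply/measurable_EFinP; exact: measurable_laplace_pdf.
under eq_integral do rewrite dE winE.
have IE x : (laplace_pdf b x * (x \in I)%:R)%:E =
    ((EFin \o laplace_pdf b) \_ [set` I]) x.
  by rewrite patchE mem_setE; case: ifP; rewrite ?mulr1 ?mulr0.
under eq_integral do rewrite IE.
rewrite ge0_integralZl//; last 2 first.
- exact/(measurable_restrictT _ _).1/measurable_funTS.
- move=> x _; apply: erestrict_ge0 => y _; rewrite lee_fin.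
  exact/ltW/laplace_pdf_gt0.
rewrite -integral_mkcond EFinM; congr (_ * _)%E.
have -> : (\int[mu]_(x in [set` I]) (EFin \o laplace_pdf b) x)%E =
    (\int[mu]_(x in `](th - s i)%R, +oo[) (laplace_pdf b x)%:E)%E.
  rewrite /I; case: (win _) => //; rewrite -integral_itv_obnd_cbnd//.
  exact: measurable_funTS.
rewrite fineK//; apply: integrable_fin_num => //.
by apply: integrableS (integrable_laplace_pdf b0).
Qed.

End WinningProbability.

(** * Integral representation of the winning probability *)

Section Representation.
Variables (R : realType) (b : R).
Hypothesis b0 : 0 < b.
Local Open Scope classical_set_scope.
Notation mu := (@lebesgue_measure R).

(* [rho t] is the joint density of the rivals' noise [t] and [th s t] their best
   noisy score. *)
Lemma win_density_integral n (i k0 : 'I_n) : k0 != i ->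
  exists d (T : measurableType d) (P : {sigma_finite_measure set T -> \bar R})
    (rho : T -> R) (th : ('I_n -> R) -> T -> R),
  [/\ (0 < P [set: T])%E, forall t, 0 < rho t,
    P.-integrable setT (EFin \o rho),
    forall s, measurable_fun setT (fun t => rho t * laplace_tail b (th s t - s i)) /\
      iter_int n (win_density b i s) =
      (\int[P]_t (rho t * laplace_tail b (th s t - s i))%:E)%E &
    forall s s' e t, (forall k, k != i -> `|s k - s' k| <= e) ->
      `|th s t - th s' t| <= e].
Proof.
move=> k0i.
have [d [T [P [X [P0 mX PX]]]]] := @iter_int_isolate R n i (ltn_ord i).
pose rho t := \prod_(j < n | j != i) laplace_pdf b (X t j).
pose th s t := best_rival i k0 (fun k => s k + X t k).
have mF f : coord_measurable f -> (forall w, 0 <= f w)%E ->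
    measurable_fun setT (fun t => \int[mu]_x f (set_coord (X t) i x))%E.
  move=> mf f0; apply: (measurable_fun_fubini_tonelli_F (m2 := mu)
    (fun z : T * measurableTypeR R => f (set_coord (X z.1) i z.2))) => //.
  by apply: mf => j; exact: (measurable_set_coord (g := id)).
have rho0 t : 0 < rho t by apply: prodr_gt0 => j _; exact: laplace_pdf_gt0.
exists d, T, P, rho, th; split => //.
- have mrho : measurable_fun [set: T] rho.
    rewrite /rho; under eq_fun do rewrite big_mkcond/=.
    apply: measurable_prod => j _; case: (j != i) => //.
    by apply: measurableT_comp (mX j); exact: measurable_laplace_pdf.
  apply/integrableP; split; first exact/measurable_EFinP.
  under eq_integral do rewrite /= gtr0_norm//.
  have m0 := laplace_mass_gt0 b0.
  have p0 w : (0 <= (\prod_(j < n) laplace_pdf b (w j))%:E)%E.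
    by rewrite lee_fin prodr_ge0// => j _; exact/ltW/laplace_pdf_gt0.
  have inE t : (\int[mu]_x (\prod_(j < n) laplace_pdf b (set_coord (X t) i x j))%:E =
      (rho t)%:E * (laplace_mass b)%:E)%E.
    transitivity (\int[mu]_x ((rho t)%:E * (laplace_pdf b x)%:E))%E.
      apply: eq_integral => x _; rewrite -EFinM; congr EFin.
      rewrite (bigD1 i)//= {1}/set_coord eqxx mulrC; congr (_ * _).
      by apply: eq_bigr => j ji; rewrite /set_coord ifN.
    rewrite ge0_integralZl//; last 3 first.
    + by apply/measurable_EFinP; exact: measurable_laplace_pdf.
    + by move=> x _; rewrite lee_fin; exact/ltW/laplace_pdf_gt0.
    + by rewrite lee_fin ltW// rho0.
    rewrite /laplace_mass fineK//.
    by apply: integrable_fin_num => //; exact: integrable_laplace_pdf.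
  (* Restoring the noise of [i] multiplies [rho] by the positive [laplace_mass b] and gives the
     finite total [laplace_mass b ^+ n], so [rho] cannot have infinite integral. *)
  have E : (\int[P]_t ((rho t)%:E * (laplace_mass b)%:E) =
      (1 * laplace_mass b ^+ n)%:E)%E.
    rewrite -(iter_int_laplace_prod b0 n (@ler01 R)).
    under [fun w => (1 * _)%:E]funext do rewrite mul1r.
    rewrite PX//; last exact: coord_measurable_laplace_prod.
    by apply: eq_integral => t _; rewrite inE.
  move: E; rewrite ge0_integralZr//; last 3 first.
  + exact/measurable_EFinP.
  + by move=> t _; rewrite lee_fin ltW// rho0.
  + by rewrite lee_fin ltW.
  move=> E; rewrite ltNge leye_eq; apply/eqP => rhooo.
  by move: E; rewrite rhooo gt0_mulye// lte_fin.
- move=> s.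
  have mw := @coord_measurable_win_density R b n i s.
  have w0 := @win_density_ge0 R b b0 n i s.
  have sE t := win_density_set_coord b0 s (X t) k0i.
  split.
    apply/measurable_EFinP; have := mF _ mw w0.
    by under eq_fun do rewrite sE.
  by rewrite PX//; apply: eq_integral => t _; rewrite sE.
- move=> s s' e t H; apply: best_rival_dist => // k ki.
  by rewrite opprD addrACA subrr addr0 H.
Qed.

(** A zero integral would make [f] vanish almost everywhere and hence the whole space null. *)
Lemma integral_gt0 d (T : measurableType d) (P : {measure set T -> \bar R})
    (f : T -> \bar R) : (0 < P setT)%E -> measurable_fun setT f ->
  (forall t, 0 < f t)%E -> (0 < \int[P]_t f t)%E.
Proof.
move=> P0 mf f0; rewrite lt_neqAle integral_ge0 ?andbT//; last first.
  by move=> t _; exact/ltW.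
apply/eqP => /esym If0.
have /(ae_eq_integral_abs P measurableT mf) [N [mN N0 sN]] :
    (\int[P]_t `|f t| = 0)%E.
  by rewrite -[RHS]If0; apply: eq_integral => t _; rewrite gee0_abs// ltW.
move: P0; rewrite (_ : [set: T] = N) ?N0 ?ltxx//.
apply/seteqP; split => // t _; apply: sN => /= /(_ I).
by move=> ft0; have := f0 t; rewrite ft0 ltxx.
Qed.

End Representation.

(** * Pairing of outcomes *)

Section Flip.
Variables (R : realType) (m : nat) (t : 'I_m).
Implicit Types (p r : 'I_m -> R) (y : {ffun 'I_m -> bool}).

Definition flip_outcome y : {ffun 'I_m -> bool} :=
  [ffun u => if u == t then ~~ y u else y u].

Definition set_report r (x : R) : 'I_m -> R := fun u => if u == t then x else r u.

Lemma flip_outcomeK : involutive flip_outcome.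
Proof.
by move=> y; apply/ffunP => u; rewrite !ffunE; case: (u == t); rewrite ?negbK.
Qed.

Lemma flip_outcome_at y : flip_outcome y t = ~~ y t.
Proof. by rewrite ffunE eqxx. Qed.

Lemma flip_outcome_off y u : u != t -> flip_outcome y u = y u.
Proof. by rewrite ffunE => /negbTE ->. Qed.

(** Flipping is a bijection, so summing over pairs counts every outcome twice. *)
Lemma sum_flip_outcome (H : {ffun 'I_m -> bool} -> R) :
  \sum_y H y = (\sum_y (H y + H (flip_outcome y))) / 2.
Proof.
rewrite big_split/= [X in _ + X](_ : _ = \sum_y H y).
  by field.
rewrite [RHS](reindex_inj (can_inj flip_outcomeK)); apply: eq_bigr => y _ //.
Qed.

Lemma total_score_flip_dist r y : in01 r ->
  `|total_score r y - total_score r (flip_outcome y)| <= 1.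
Proof.
move=> r01; rewrite /total_score (bigD1 t)//= [X in _ - X](bigD1 t)//=.
rewrite (eq_bigr (fun u => qscore (r u) (flip_outcome y u))); last first.
  by move=> u ut; rewrite flip_outcome_off.
rewrite opprD addrACA subrr addr0.
have /andP[a0 a1] := qscore_in01 (y t) (r01 t).
have /andP[c0 c1] := qscore_in01 (flip_outcome y t) (r01 t).
by rewrite ler_norml; apply/andP; split; lra.
Qed.

Lemma expected_tail_gain (gamma b : R) p r (Z : {ffun 'I_m -> bool} -> R) :
  0 < gamma -> gamma <= 1 -> b = 4 / gamma ->
  in01 p -> in01 r -> gamma < `|r t - p t| ->
  (forall y, `|Z y - Z (flip_outcome y)| <= 1) ->
  0 < \sum_y outcome_prob p y *
    (laplace_tail b (Z y - total_score (set_report r (p t)) y) -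
     laplace_tail b (Z y - total_score r y)).
Proof.
move=> g0 g1 bE p01 r01 hD hZ.
pose H y := outcome_prob p y *
  (laplace_tail b (Z y - total_score (set_report r (p t)) y) -
   laplace_tail b (Z y - total_score r y)).
rewrite -/(\sum_y H y) sum_flip_outcome divr_gt0//.
(* [Q] and [A] are the probability and the score contributed by the events other than [t]; both are
   invariant under the flip. *)
pose Q y := \prod_(u < m | u != t) (if y u then p u else 1 - p u).
pose A y := \sum_(u < m | u != t) qscore (r u) (y u).
have Q0 y : 0 <= Q y.
  by apply: prodr_ge0 => u _; have /andP[] := p01 u; case: (y u) => //; lra.
have QF y : Q (flip_outcome y) = Q y.
  by apply: eq_bigr => u ut; rewrite flip_outcome_off.
have AF y : A (flip_outcome y) = A y.
  by apply: eq_bigr => u ut; rewrite flip_outcome_off.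
have HE y : H y = (if y t then p t else 1 - p t) * Q y *
    (laplace_tail b (Z y - A y - qscore (p t) (y t)) -
     laplace_tail b (Z y - A y - qscore (r t) (y t))).
  rewrite /H /outcome_prob (bigD1 t)//=; congr (_ * (laplace_tail b _ - laplace_tail b _)).
    rewrite /total_score (bigD1 t)//= {1}/set_report eqxx opprD [- _ - _]addrC addrA.
    by congr (_ - _ - _); apply: eq_bigr => u ut; rewrite /set_report ifN.
  by rewrite /total_score (bigD1 t)//= opprD [- _ - _]addrC addrA.
have HG y : exists2 c, 0 < c & H y + H (flip_outcome y) = Q y * c.
  rewrite !HE QF AF flip_outcome_at; case: (y t) => /=.
    eexists; last by rewrite -[LHS]/(p t * _ * _ + (1 - p t) * _ * _)
      ![_ * Q y]mulrC -!mulrA -mulrDr.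
    exact: (expected_gain g0 g1 bE).
  eexists; last by rewrite addrC -[LHS]/(p t * _ * _ + (1 - p t) * _ * _)
    ![_ * Q y]mulrC -!mulrA -mulrDr.
  by apply: (expected_gain g0 g1 bE) => //; rewrite distrC.
(* Strictness needs one pair of positive weight: [y0] takes at each event a value that has positive
   probability. *)
pose y0 := [ffun u => 0 < p u] : {ffun 'I_m -> bool}.
have Qy0 : 0 < Q y0.
  apply: prodr_gt0 => u _; rewrite ffunE; case: ifP => // /negbT.
  by rewrite -leNgt => pu; lra.
rewrite (bigD1 y0)//= ltr_pwDl//.
  by have [c c0 ->] := HG y0; rewrite mulr_gt0.
apply: sumr_ge0 => y _; have [c c0 ->] := HG y.
by rewrite mulr_ge0// ltW.
Qed.
End Flip.

(** * Dominated and undominated reports *)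

Local Open Scope classical_set_scope.

Section Lipschitz.
Variables (R : realType) (f : R -> R) (K : R).

Lemma lipschitz_real_continuous :
  (forall x y, `|f x - f y| <= K * `|x - y|) -> continuous f.
Proof.
move=> Hf x; apply/cvgrPdist_le => e e0.
have K0 : 0 < 1 + `|K| by rewrite ltr_pwDl.
near=> y; apply: (le_trans (Hf x y)).
apply: (@le_trans _ _ ((1 + `|K|) * `|x - y|)).
  by rewrite ler_wpM2r// (le_trans (ler_norm K))// lerDr.
rewrite mulrC -ler_pdivlMr//.
near: y; apply: cvgr_dist_le; last by rewrite divr_gt0.
exact: cvg_id.
Unshelve. all: by end_near. Qed.
End Lipschitz.

Lemma cvg_sum (R : realType) (T : Type) (F : set_system T) {FF : Filter F} (I : Type)
    (r : seq I) (f : I -> T -> R) (l : I -> R) :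
  (forall k, f k x @[x --> F] --> l k) ->
  \sum_(k <- r) f k x @[x --> F] --> \sum_(k <- r) l k.
Proof.
move=> fl; elim: r => [|k r IH].
  by rewrite big_nil; under eq_fun do rewrite big_nil; exact: cvg_cst.
by rewrite big_cons; under eq_fun do rewrite big_cons; exact: cvgD.
Qed.

Lemma continuous_qscore (R : realType) y : continuous (fun q : R => qscore q y).
Proof.
move=> q; apply: cvgB; first exact: cvg_cst.
apply: (@continuous_cvg _ R R (nbhs q) _ (fun x : R => (y%:R : R) - x)
  (fun x : R => x ^+ 2)); first exact: exprn_continuous.
by apply: cvgB; [exact: cvg_cst|exact: cvg_id].
Qed.

Lemma compact_unit_cube (R : realType) m :
  compact [set v : 'rV[R]_m | forall u, 0 <= v ord0 u <= 1].
Proof.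
have := @rV_compact R m (fun=> `[0, 1]%classic) (fun=> @segment_compact R 0 1).
congr compact; apply/seteqP; split => v /= v01 u; have := v01 u;
  by rewrite in_itv.
Qed.

Section Truthful.
Variables (R : realType) (n m : nat) (b : R).
Hypothesis b0 : 0 < b.
Local Open Scope classical_set_scope.

Lemma outcome_prob_ge0 (p : 'I_m -> R) y : in01 p -> 0 <= outcome_prob p y.
Proof.
move=> p01; apply: prodr_ge0 => u _; have /andP[] := p01 u.
by case: (y u) => //; lra.
Qed.

Definition scores (Rep : 'I_n -> 'I_m -> R) y : 'I_n -> R :=
  fun j => total_score (Rep j) y.

(** * Consequences of the representation provided by [win_density_integral] *)

Section Represented.
Variables (i : 'I_n) (d : measure_display) (T : measurableType d).
Variables (P : {sigma_finite_measure set T -> \bar R}) (rho : T -> R).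
Variable th : ('I_n -> R) -> T -> R.
Hypothesis P0 : (0 < P [set: T])%E.
Hypothesis rho0 : forall t, 0 < rho t.
Hypothesis irho : P.-integrable setT (EFin \o rho).
Hypothesis mtail : forall s,
  measurable_fun setT (fun t => rho t * laplace_tail b (th s t - s i)).
Hypothesis winE : forall s, iter_int n (win_density b i s) =
  (\int[P]_t (rho t * laplace_tail b (th s t - s i))%:E)%E.
Hypothesis th_dist : forall s s' e t,
  (forall k, k != i -> `|s k - s' k| <= e) -> `|th s t - th s' t| <= e.

Lemma integrable_tail s :
  P.-integrable setT (EFin \o (fun t => rho t * laplace_tail b (th s t - s i))).
Proof.
apply: (@le_integrable _ _ _ P _ measurableT _
    (fun t => ((laplace_mass b)%:E * (EFin \o rho) t)%E)).
- by apply/measurable_EFinP; exact: mtail.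
- move=> t _ /=; rewrite lee_fin mulrC !normrM ler_wpM2r//.
  rewrite !ger0_norm ?laplace_tail_ge0//; first exact: laplace_tail_le_mass.
  exact: (le_trans (laplace_tail_ge0 b0 0) (laplace_tail_le_mass b0 0)).
- exact: integrableZl.
Qed.

(** The case of distance 0 in [th_dist]: the threshold ignores the report of [i]. *)
Lemma th_upd_report (Rep : 'I_n -> 'I_m -> R) r r' y t :
  th (scores (upd_report Rep i r) y) t = th (scores (upd_report Rep i r') y) t.
Proof.
apply/eqP; rewrite -subr_eq0 -normr_le0; apply: th_dist => k ki.
by rewrite /scores /upd_report !ifN// subrr normr0.
Qed.

(** The sum over outcomes is placed inside the integral so that two reports can be compared for each
    noise of the rivals separately. *)
Definition exp_win_density (p : 'I_m -> R) (Rep : 'I_n -> 'I_m -> R) t : R :=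
  \sum_(y : {ffun 'I_m -> bool}) outcome_prob p y *
    (rho t * laplace_tail b (th (scores Rep y) t - total_score (Rep i) y)).

Lemma integrable_exp_win_density p Rep : in01 p ->
  P.-integrable setT (EFin \o exp_win_density p Rep).
Proof.
move=> p01; rewrite (_ : EFin \o _ = fun t =>
  (\sum_(y : {ffun 'I_m -> bool}) (outcome_prob p y)%:E *
    (rho t * laplace_tail b (th (scores Rep y) t - scores Rep y i))%:E)%E).
  by apply: integrable_sum => // y _; apply: integrableZl => //; exact: integrable_tail.
by apply/funext => t; rewrite /= /exp_win_density -sumEFin.
Qed.

Lemma RNM_exp_winE p Rep : in01 p ->
  RNM_exp_win b Rep p i = (\int[P]_t (exp_win_density p Rep t)%:E)%E.
Proof.
move=> p01; under eq_integral do rewrite /exp_win_density -sumEFin.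
rewrite ge0_integral_sum//; last 2 first.
- move=> y; apply/measurable_EFinP; apply: measurable_funM; first exact: measurable_cst.
  exact: mtail.
- move=> y t _; rewrite lee_fin mulr_ge0 ?outcome_prob_ge0// mulr_ge0//.
    exact: ltW.
  exact: laplace_tail_ge0.
apply: eq_bigr => y _; under eq_integral do rewrite EFinM.
rewrite ge0_integralZl//.
- by congr (_ * _)%E; exact: winE.
- by apply/measurable_EFinP; exact: mtail.
- move=> t _; rewrite lee_fin mulr_ge0//.
    exact: ltW.
  exact: laplace_tail_ge0.
- by rewrite lee_fin outcome_prob_ge0.
Qed.

Lemma set_report_dominates (gamma : R) (p r : 'I_m -> R) (t : 'I_m) :
  0 < gamma -> gamma <= 1 -> b = 4 / gamma ->
  in01 p -> in01 r -> gamma < `|r t - p t| ->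
  strictly_dominates b p i (set_report t r (p t)) r.
Proof.
move=> g0 g1 bE p01 r01 hD Rep Rep01.
rewrite !RNM_exp_winE//.
set F := exp_win_density p _; set F' := exp_win_density p _.
have iF : P.-integrable setT (EFin \o F) by exact: integrable_exp_win_density.
have iF' : P.-integrable setT (EFin \o F') by exact: integrable_exp_win_density.
have FF' w : 0 < F' w - F w.
  rewrite /F' /F /exp_win_density -sumrB.
  rewrite (eq_bigr (fun y => rho w * (outcome_prob p y *
      (laplace_tail b (th (scores (upd_report Rep i r) y) w -
         total_score (set_report t r (p t)) y) -
       laplace_tail b (th (scores (upd_report Rep i r) y) w -
         total_score r y))))); last first.
    move=> y _; rewrite (th_upd_report Rep (set_report t r (p t)) r).
    by rewrite /upd_report eqxx; ring.
  (* The threshold plays the role of [Z]: a flip moves every rival's score by at most 1, hence also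
     the threshold. *)
  rewrite -mulr_sumr mulr_gt0//; apply: (expected_tail_gain g0 g1 bE) => // y.
  apply: th_dist => k ki; apply: total_score_flip_dist.
  by rewrite /upd_report ifN//; exact: Rep01.
rewrite -sube_gt0 -integralB//; apply: integral_gt0 => //.
  by apply: emeasurable_funB; exact: (measurable_int P).
Qed.

(** The report of [i] acts only through its total score [c], and the integral [V y c] is Lipschitz
    in [c] because the tail is and [rho] is integrable. *)
Lemma exp_win_continuous (p : 'I_m -> R) (Rep : 'I_n -> 'I_m -> R) :
  in01 p ->
  continuous (fun v : 'rV[R]_m =>
    fine (RNM_exp_win b (upd_report Rep i (v ord0)) p i)).
Proof.
move=> p01; pose th0 y := th (scores (upd_report Rep i (fun=> 0)) y).
pose V y c := \int[P]_t (rho t * laplace_tail b (th0 y t - c)).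
(* The section hypotheses concern full score vectors; this one gives [i] an arbitrary score [c] and
   leaves the rivals unchanged. *)
pose s y c k : R := if k == i then c else scores (upd_report Rep i (fun=> 0)) y k.
have sE y c t : rho t * laplace_tail b (th0 y t - c) =
    rho t * laplace_tail b (th (s y c) t - s y c i).
  rewrite /s eqxx; congr (_ * laplace_tail b (_ - _)).
  apply/eqP; rewrite -subr_eq0 -normr_le0; apply: th_dist => k ki.
  by rewrite ifN// subrr normr0.
have iV y c : P.-integrable setT
    (EFin \o (fun t => rho t * laplace_tail b (th0 y t - c))).
  by under eq_fun do rewrite sE; exact: integrable_tail.
have VE v : fine (RNM_exp_win b (upd_report Rep i (v ord0)) p i) =
    \sum_(y : {ffun 'I_m -> bool}) outcome_prob p y * V y (total_score (v ord0) y).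
  rewrite RNM_exp_winE//.
  rewrite (_ : (\int[P]_t _)%E = (\sum_(y : {ffun 'I_m -> bool})
     (outcome_prob p y * V y (total_score (v ord0) y))%:E)%E); last first.
    rewrite /exp_win_density.
    under eq_integral do rewrite -sumEFin.
    under eq_integral => t _.
      under eq_bigr => y _.
        rewrite (th_upd_report Rep (v ord0) (fun=> 0)) /upd_report eqxx EFinM.
        over.
      over.
    rewrite integral_sum//; last first.
      by move=> y; apply: integrableZl => //; exact: iV.
    apply: eq_bigr => y _; rewrite integralZl//; last exact: iV.
    by rewrite EFinM /V /Rintegral fineK//; apply: integrable_fin_num => //; exact: iV.
  by rewrite sumEFin.
have Vlip y c c' : `|V y c - V y c'| <=
    (\int[P]_t rho t) * (2 * b)^-1 * `|c - c'|.
  rewrite /V -RintegralB//; try exact: iV.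
  have iB := integrableB measurableT (iV y c) (iV y c').
  apply: (le_trans (le_normr_Rintegral _ _)) => //.
  rewrite -mulrA -RintegralZr//; apply: le_Rintegral => //.
  - exact: integrable_norm.
  - have -> : EFin \o (fun t => rho t * ((2 * b)^-1 * `|c - c'|)) =
      (fun t => (EFin \o rho) t * ((2 * b)^-1 * `|c - c'|)%:E)%E by [].
    exact: integrableZr.
  - move=> t _; rewrite -mulrBr normrM (ger0_norm (ltW (rho0 t))).
    rewrite ler_wpM2l ?(ltW (rho0 t))//.
    rewrite (le_trans (laplace_tail_lipschitz b0 _ _))// ler_wpM2l//.
      by rewrite invr_ge0 mulr_ge0// ltW.
    by rewrite opprD opprK addrACA subrr add0r addrC distrC.
rewrite (_ : (fun v => _) = (fun v : 'rV[R]_m => \sum_(y : {ffun 'I_m -> bool})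
    outcome_prob p y * V y (total_score (v ord0) y))); last exact/funext.
move=> v; apply: (@cvg_sum _ _ (nbhs v) _) => y; apply: cvgM; first exact: cvg_cst.
apply: continuous_cvg; first exact: (lipschitz_real_continuous (Vlip y)).
rewrite /total_score; apply: (@cvg_sum _ _ (nbhs v) _) => u.
apply: (@continuous_cvg _ R R (nbhs v) _ (fun w : 'rV[R]_m => w ord0 u)
  (fun q => qscore q (y u)) (v ord0 u)).
  exact: continuous_qscore.
exact: (@coord_continuous R 1 m ord0 u v).
Qed.

(** A dominating report must be strictly better against every profile of rivals, so a maximiser
    against the single profile [Rep0] is undominated. Compactness of the cube provides one. *)
Lemma exists_undominated (p : 'I_m -> R) : in01 p -> exists r, undominated b p i r.
Proof.
move=> p01; pose Rep0 : 'I_n -> 'I_m -> R := fun _ _ => 0.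
pose A := [set v : 'rV[R]_m | forall u, 0 <= v ord0 u <= 1].
have A0 : A !=set0 by exists 0 => u /=; rewrite mxE lexx ler01.
have [c cAin cmax] := EVT_max_rV A0 (@compact_unit_cube R m)
  (continuous_subspaceT (@exp_win_continuous p Rep0 p01)).
have c01 : in01 (c ord0).
  by move: cAin; rewrite inE.
exists (c ord0); split; first exact: c01.
move=> [rhat [rhat01 dom]].
have z01 j : j != i -> in01 (Rep0 j) by move=> _ u; rewrite /Rep0 lexx ler01.
have := dom Rep0 z01.
have fin r : RNM_exp_win b (upd_report Rep0 i r) p i \is a fin_num.
  rewrite RNM_exp_winE//; apply: integrable_fin_num => //.
  exact: integrable_exp_win_density.
have rowE : (\row_u rhat u) ord0 = rhat by apply/funext => u; rewrite mxE.
have vA : \row_u rhat u \in A.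
  by rewrite inE => u; rewrite mxE; exact: rhat01.
have := cmax _ vA; rewrite rowE => le.
by rewrite -[ltLHS]fineK// -[ltRHS]fineK// lte_fin ltNge le.
Qed.

End Represented.
End Truthful.

Theorem mainTheorem16 (R : realType) (n m : nat) (gamma : R) :
  (2 <= n)%N -> 0 < gamma -> gamma <= 1 ->
  approx_truthful n m (4 / gamma) gamma.
Proof.
move=> n2 g0 g1 i p p01.
have b0 : 0 < 4 / gamma by rewrite divr_gt0.
(* A rival exists because [2 <= n]: index 1 if [i] is 0, and index 0 otherwise. *)
have [k0 k0i] : exists k0 : 'I_n, k0 != i.
  case: (eqVneq (i : nat) 0) => [i0|i0].
    by exists (Ordinal n2); rewrite -val_eqE /= i0.
  by exists (Ordinal (ltnW n2)); rewrite -val_eqE /= eq_sym.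
have [d [T [P [rho [th [P0 rho0 irho win th_dist]]]]]] := win_density_integral b0 k0i.
have mtail s := (win s).1; have winE s := (win s).2.
split; first exact: (exists_undominated b0 rho0 irho mtail winE th_dist).
move=> r [r01 undom] t; rewrite leNgt; apply/negP => hD; apply: undom.
exists (set_report t r (p t)); split.
  by move=> u; rewrite /set_report; case: ifP.
exact: (set_report_dominates b0 P0 rho0 irho mtail winE th_dist g0 g1).
Qed.
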